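(* Suppose that $0\le\rho_j<1$, $\kappa_{M_j}>0$, $\kappa_{D_i}>0$, $\delta_{M_j}\ge 0$ and $\sum_{i\in\mathcal D_{M_j}}\mathrm{SV}_{i\mid j}=1$ for all models $M_j$ and datasets $D_i$ of a data–model coupled market (as defined in the context). Then the joint quotation operator $\mathcal Q:\mathbb R_+^d\to\mathbb R_+^d$ admits a unique finite fixed point, i.e. there is exactly one $\mathbf p^\star\in\mathbb R_+^d$ with $\mathbf p^\star=\mathcal Q(\mathbf p^\star)$.
   Context: Market data: finitely many datasets $D_1,\dots,D_\ell$ and models $M_1,\dots,M_J$. Each model $M_j$ has a finite set $\mathcal D_{M_j}$ of datasets it uses (we write $i\in\mathcal D_{M_j}$ for $D_i\in\mathcal D_{M_j}$) and a finite set $\mathcal B_{M_j}$ of buyers ($k\in\mathcal B_{M_j}$ for $B_k\in\mathcal B_{M_j}$). Parameters: real offsets $\kappa_{M_j}$ and $\kappa_{D_i}$; margins $\delta_{M_j}$; Shapley weights $\mathrm{SV}_{i\mid j}\ge 0$; buyer weights $\omega_{jk}\ge 0$ with $\sum_{k\in\mathcal B_{M_j}}\omega_{jk}=\rho_j$ for each $j$. A price vector $\mathbf p\in\mathbb R_+^d$, $d=\sum_j|\mathcal B_{M_j}|+\sum_j|\mathcal D_{M_j}|$, has one coordinate $p_{B_k\to M_j}$ for each $j$ and $k\in\mathcal B_{M_j}$, and one coordinate $p_{D_i\to M_j}$ for each $j$ and $i\in\mathcal D_{M_j}$. The joint quotation operator $\mathcal Q$ is defined by $$\mathcal Q(\mathbf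 p)_{B_k\to M_j}=\kappa_{M_j}+(1+\delta_{M_j})\sum_{i\in\mathcal D_{M_j}}p_{D_i\to M_j},$$ $$\mathcal Q(\mathbf p)_{D_i\to M_j}=\kappa_{D_i}+\frac{\mathrm{SV}_{i\mid j}}{1+\delta_{M_j}}\,W_j,\qquad W_j=\sum_{k\in\mathcal B_{M_j}}\omega_{jk}\,p_{B_k\to M_j}.$$ *)

(* Defs.v *)
From mathcomp Require Import all_boot all_order all_algebra.
From mathcomp Require Import reals.

Set Implicit Arguments.
Unset Strict Implicit.
Unset Printing Implicit Defensive.

Import Order.TTheory GRing.Theory Num.Theory.
Local Open Scope ring_scope.

(* [sv M j i] is SV_{i|j} and [omega M j k] is omega_{jk}. Both are total
   functions, but only their values at members of [datasets M j], resp.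
   [buyers M j], are constrained or used. *)
Record market (R : realType) (l J m : nat) := Market {
  datasets : 'I_J -> {set 'I_l};
  buyers : 'I_J -> {set 'I_m};
  kappaM : 'I_J -> R;
  kappaD : 'I_l -> R;
  delta : 'I_J -> R;
  sv : 'I_J -> 'I_l -> R;
  omega : 'I_J -> 'I_m -> R;
  sv_ge0 : forall j i, i \in datasets j -> 0 <= sv j i;
  omega_ge0 : forall j k, k \in buyers j -> 0 <= omega j k
}.

Section Market.
Variables (R : realType) (l J m : nat) (M : market R l J m).

Definition rho (j : 'I_J) : R := \sum_(k in buyers M j) omega M j k.

Definition buyer_of (j : 'I_J) : finType := {k : 'I_m | k \in buyers M j}.
Definition dataset_of (j : 'I_J) : finType := {i : 'I_l | i \in datasets M j}.

Definition coord : finType :=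
  ({j : 'I_J & buyer_of j} + {j : 'I_J & dataset_of j})%type.

Definition buyer_coord (j : 'I_J) (k : buyer_of j) : coord :=
  inl (Tagged buyer_of k).
Definition dataset_coord (j : 'I_J) (i : dataset_of j) : coord :=
  inr (Tagged dataset_of i).

Lemma card_coord :
  #|coord| = (\sum_j #|buyers M j| + \sum_j #|datasets M j|)%N.
Proof.
rewrite card_sum !card_tagged !sumnE !big_map -!enumT !big_enum /=.
by congr (_ + _)%N; apply: eq_bigr => j _; rewrite card_sig.
Qed.

Definition price : Type := {ffun coord -> R}.

Definition nonneg (p : price) : Prop := forall c : coord, 0 <= p c.

Definition weighted_price (p : price) (j : 'I_J) : R :=
  \sum_(k : buyer_of j) omega M j (val k) * p (buyer_coord k).

Definition quotation (p : price) : price :=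
  [ffun c : coord =>
    match c with
    | inl (existT j _) =>
        kappaM M j
        + (1 + delta M j) * \sum_(i : dataset_of j) p (dataset_coord i)
    | inr (existT j i) =>
        kappaD M (val i)
        + sv M j (val i) / (1 + delta M j) * weighted_price p j
    end].

End Market.

(* Main.v *)
Require Import Defs.
From mathcomp Require Import all_boot all_order all_algebra.
From mathcomp Require Import reals ring.
Import Order.TTheory GRing.Theory Num.Theory.
Local Open Scope ring_scope.

(** Summing the fixed-point equations over the datasets and over the buyers of
    model [j], with [\sum_i SV_{i|j} = 1], gives
    [W_j = rho_j * (kappaM_j + (1 + delta_j) * K_j + W_j)], where [K_j] is the
    sum of the [kappaD_i] over the datasets of model [j]. As [rho_j < 1], this
    scalar equation has exactly one solution, and it is nonnegative; a fixed
    point is in turn determined by its weighted prices [W_j]. *)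

Set Implicit Arguments.
Unset Strict Implicit.

Section Equilibrium.
Variables (R : realType) (l J m : nat) (M : market R l J m).
Implicit Types (p : price M) (j : 'I_J) (W : 'I_J -> R).

Definition dataset_total p j : R :=
  \sum_(i : dataset_of M j) p (dataset_coord i).

(** The part of the fixed-point buyer price of model [j] that is left when [W_j] is set aside: the
    datasets pass on [W_j] divided by the margin factor, and the buyer price multiplies it back. *)
Definition base_cost j : R :=
  kappaM M j + (1 + delta M j) * \sum_(i in datasets M j) kappaD M i.

(** The buyer coordinates already have the dataset prices summed in, so that each coordinate depends
    on [W] at a single model. *)
Definition price_of_weight W : price M :=
  [ffun c : Defs.coord M =>
    match c with
    | inl (existT j _) => base_cost j + W j
    | inr (existT j i) =>
        kappaD M (val i) + sv M j (val i) / (1 + delta M j) * W j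
    end].

Definition equilibrium_weight j : R := rho M j * base_cost j / (1 - rho M j).

Lemma margin_gt0 j : 0 <= delta M j -> 0 < 1 + delta M j.
Proof. by move=> ?; rewrite ltr_wpDr. Qed.

Lemma base_cost_ge0 j :
  0 <= delta M j -> 0 < kappaM M j -> (forall i, 0 < kappaD M i) ->
  0 <= base_cost j.
Proof.
move=> hd hM hD; rewrite addr_ge0 ?(ltW hM) // mulr_ge0 //.
  exact: ltW (margin_gt0 hd).
by apply: sumr_ge0 => i _; apply: ltW.
Qed.

Lemma equilibrium_weight_ge0 j :
  0 <= rho M j < 1 -> 0 <= base_cost j -> 0 <= equilibrium_weight j.
Proof.
by case/andP=> r0 r1 b0; rewrite divr_ge0 ?mulr_ge0 // subr_ge0 ltW.
Qed.

Lemma equilibrium_weightP j (w : R) :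
  rho M j < 1 -> w = rho M j * (base_cost j + w) <-> w = equilibrium_weight j.
Proof.
rewrite -subr_gt0 => /lt0r_neq0 nz; split=> [e|->].
  (* After multiplication by [1 - rho M j], only the first [w] is replaced by its equation, so that
     the remaining ones cancel. *)
  by apply: (mulIf nz); rewrite divfK // mulrBr mulr1 {1}e; ring.
by rewrite /equilibrium_weight; field.
Qed.

(** All buyers of [j] face one price, which leaves the weighted sum with the factor [rho M j]. *)
Lemma weighted_price_price_of_weight W j :
  weighted_price (price_of_weight W) j = rho M j * (base_cost j + W j).
Proof.
rewrite /weighted_price /rho mulr_suml [RHS]big_sub.
by apply: eq_bigr => k _; rewrite ffunE.
Qed.

Lemma weighted_price_quotation p j :
  weighted_price (quotation p) j =
  rho M j * (kappaM M j + (1 + delta M j) * dataset_total p j).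
Proof.
rewrite /weighted_price /rho mulr_suml [RHS]big_sub.
by apply: eq_bigr => k _; rewrite ffunE.
Qed.

Lemma sum_dataset_price j (w : R) :
  \sum_(i in datasets M j) sv M j i = 1 ->
  \sum_(i : dataset_of M j)
     (kappaD M (val i) + sv M j (val i) / (1 + delta M j) * w) =
  \sum_(i in datasets M j) kappaD M i + w / (1 + delta M j).
Proof.
move=> hsv; rewrite big_split /= -!mulr_suml -(big_sub _ (kappaD M)) -(big_sub _ (sv M j)) hsv mul1r.
by rewrite [_^-1 * _]mulrC.
Qed.

Lemma quotation_ge0 p :
  (forall j, 0 <= delta M j) ->
  (forall j, 0 < kappaM M j) -> (forall i, 0 < kappaD M i) ->
  nonneg p -> nonneg (quotation p).
Proof.
move=> hd hM hD p_ge0 [[j k]|[j i]]; rewrite ffunE.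
  rewrite addr_ge0 ?(ltW (hM j)) // mulr_ge0 ?(ltW (margin_gt0 (hd j))) //.
  exact: sumr_ge0.
rewrite addr_ge0 ?(ltW (hD _)) // mulr_ge0 //.
  by rewrite divr_ge0 ?(ltW (margin_gt0 (hd j))) ?sv_ge0 ?(valP i).
by apply: sumr_ge0 => k _; rewrite mulr_ge0 ?omega_ge0 ?(valP k).
Qed.

Lemma price_of_weight_ge0 W :
  (forall j, 0 <= delta M j) ->
  (forall j, 0 < kappaM M j) -> (forall i, 0 < kappaD M i) ->
  (forall j, 0 <= W j) -> nonneg (price_of_weight W).
Proof.
move=> hd hM hD W_ge0 [[j k]|[j i]]; rewrite ffunE.
  by rewrite addr_ge0 ?base_cost_ge0.
rewrite addr_ge0 ?(ltW (hD _)) // mulr_ge0 //.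
by rewrite divr_ge0 ?(ltW (margin_gt0 (hd j))) ?sv_ge0 ?(valP i).
Qed.

(** Buyer coordinates agree because the Shapley weights sum to one; dataset coordinates agree
    because the equation for [W] makes [W j] the weighted price of the constructed vector. *)
Lemma quotation_price_of_weight W :
  (forall j, 0 <= delta M j) ->
  (forall j, \sum_(i in datasets M j) sv M j i = 1) ->
  (forall j, W j = rho M j * (base_cost j + W j)) ->
  quotation (price_of_weight W) = price_of_weight W.
Proof.
move=> hd hsv eW; apply/ffunP => -[[j k]|[j i]]; rewrite !ffunE; last first.
  by rewrite weighted_price_price_of_weight -eW.
under eq_bigr do rewrite ffunE /=.
have nz := lt0r_neq0 (margin_gt0 (hd j)).
by rewrite sum_dataset_price // /base_cost; field.
Qed.

Lemma fixpoint_price_of_weight p :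
  (forall j, 0 <= delta M j) ->
  (forall j, \sum_(i in datasets M j) sv M j i = 1) ->
  p = quotation p ->
  p = price_of_weight (weighted_price p) /\
  forall j, weighted_price p j = rho M j * (base_cost j + weighted_price p j).
Proof.
move=> hd hsv ep.
(* Eliminating the dataset prices through their own equations expresses the common buyer price by
   [W_j] alone; both conclusions rest on this. *)
have buyer_price j : kappaM M j + (1 + delta M j) * dataset_total p j =
    base_cost j + weighted_price p j.
  have -> : dataset_total p j =
      \sum_(i in datasets M j) kappaD M i + weighted_price p j / (1 + delta M j).
    rewrite -sum_dataset_price //; apply: eq_bigr => i _.
    by rewrite {1}ep ffunE.
  have nz := lt0r_neq0 (margin_gt0 (hd j)).
  by rewrite /base_cost; field.
split=> [|j]; last by rewrite {1}ep weighted_price_quotation buyer_price.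
by rewrite {1}ep; apply/ffunP => -[[j k]|[j i]]; rewrite !ffunE -?buyer_price.
Qed.

End Equilibrium.

Unset Implicit Arguments.
Set Strict Implicit.

Theorem theorem2 (R : realType) (l J m : nat) (M : market R l J m)
  (hrho : forall j : 'I_J, 0 <= rho M j < 1)
  (hkappaM : forall j : 'I_J, 0 < kappaM M j)
  (hkappaD : forall i : 'I_l, 0 < kappaD M i)
  (hdelta : forall j : 'I_J, 0 <= delta M j)
  (hsv : forall j : 'I_J, \sum_(i in datasets M j) sv M j i = 1) :
  (forall p : price M, nonneg p -> nonneg (quotation p)) /\
  (exists! p : price M, nonneg p /\ p = quotation p).
Proof.
have rho_lt1 j : rho M j < 1 by case/andP: (hrho j).
split=> [p|]; first exact: quotation_ge0.
exists (price_of_weight M (equilibrium_weight M)).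
split=> [|p [_ /fixpoint_price_of_weight [] // ep eW]].
  split.
    apply: price_of_weight_ge0 => // j.
    by rewrite equilibrium_weight_ge0 ?base_cost_ge0.
  by rewrite quotation_price_of_weight // => j; apply/equilibrium_weightP.
(* Both vectors are built from weights, and at each [j] the scalar equation forces these weights to
   coincide. *)
rewrite [RHS]ep; apply/ffunP => -[[j k]|[j i]]; rewrite !ffunE;
  by have /equilibrium_weightP <- := eW j.
Qed.
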